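(* Let $p$ be a prime, $F$ an infinite field of characteristic $p$, $G$ a cyclic group of order $p$, with $p\ge 5$ so that the indecomposable $G$-module $V_4$ of dimension $4$ exists. Identify $F[V_4]$ with $F[x_1,x_2,x_3,x_4]$ and let $$M=\{x_1,\ x_2^2,\ x_2x_3^{p-3},\ x_3^{p-1},\ x_4^p\},$$ a generating set of the Hilbert ideal $H(V_4)$. Then there is a monomial order such that $H(V_4)$ is Borel fixed. Furthermore, there are $4!$ generic initial ideals of $H(V_4)$ (as the monomial order varies over all monomial orders on $F[V_4]$). Each of them is generated by $\pi(M)$ for some permutation $\pi$ of the variables in $F[V_4]$.
   Context: For $n\le p$, $V_n$ is the indecomposable $G$-module over $F$ of dimension $n$ on which a generator of $G$ acts by a single Jordan block with $1$'s on the diagonal. For a $G$-module $V$, $F[V]=S(V^* )$ is the symmetric algebra on $V^*$, a polynomial ring on a basis of $V^*$. The Hilbert ideal $H(V)$ is the ideal of $F[V]$ generated by all homogeneous $G$-invariants of positive degree. It is a known result that, for a suitable (triangular) basis $x_1,\dots,x_4$ of $V_4^*$, which is fixed here, $M$ generates $H(V_4)$. A permutation of the variables acts on $F[V_4]$ by the corresponding $F$-algebra automorphism. Given a monomial order $>$ whose ranking of the $N$ variables is $u_1>u_2>\cdots>u_N$, an upper triangular matrix $\theta=(\theta_{ij})\in GL_N(F)$ acts by the $F$-algebra automorphism $u_j\mapsto\sum_{i\le j}\theta_{ij}u_i$; an ideal is Borel fixed (with respect to $>$) if it is mapped into itself by all such $\theta$. For a homogeneous ideal $I$ and monomial order $>$,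 $\operatorname{In}_>(I)$ is the ideal generated by initial monomials of elements of $I$, and $\operatorname{gin}_>(I)$ is the monomial ideal $J$ such that $\operatorname{In}_>(\alpha(I))=J$ for all $\alpha$ in a nonempty Zariski open subset of the group of invertible linear substitutions of the variables. The generic initial ideals of $I$ are the ideals $\operatorname{gin}_>(I)$ for the various monomial orders $>$. *)

(* Defs.v *)
From mathcomp Require Export all_boot all_order all_fingroup all_algebra.
From mathcomp Require Export all_solvable all_character.
From mathcomp Require Export mpoly.
From mathcomp Require Export classical_sets cardinality.

Set Implicit Arguments.
Unset Strict Implicit.
Unset Printing Implicit Defensive.

Import GRing.Theory.

Local Open Scope classical_set_scope.
Local Open Scope ring_scope.

Definition ideal_gen (R : comNzRingType) (S : set R) : set R :=
  [set f | exists k (c s : 'I_k -> R),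
             (forall i, S (s i)) /\ f = \sum_i c i * s i].

Definition lin_subst (F : fieldType) (n : nat) (A : 'M[F]_n)
    (f : {mpoly F[n]}) : {mpoly F[n]} :=
  f \mPo [tuple \sum_(i < n) A i j *: 'X_i | j < n].

Definition jordan1 (F : fieldType) (n : nat) : 'M[F]_n :=
  \matrix_(i, j) ((j == i :> nat) || (j == i.+1 :> nat))%:R.

Definition is_V (F : fieldType) (gT : finGroupType) (G : {group gT})
    (n : nat) (rV : mx_representation F G n) : Prop :=
  exists2 g, generator G g & rV g ~_{in unitmx} jordan1 F n.

(* A representation acts on column vectors on the left, and 'X_j is the j-th
   coordinate function v |-> v j 0, so g sends 'X_j to the linear form
   v |-> (rV g^-1 *m v) j 0. *)
Definition poly_act (F : fieldType) (gT : finGroupType) (G : {group gT})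
    (n : nat) (rV : mx_representation F G n) (g : gT) :
    {mpoly F[n]} -> {mpoly F[n]} :=
  lin_subst (rV g^-1%g)^T.

Definition hilbert_ideal (F : fieldType) (gT : finGroupType) (G : {group gT})
    (n : nat) (rV : mx_representation F G n) : set {mpoly F[n]} :=
  ideal_gen [set f | (exists2 d, (0 < d)%N & f \is d.-homog) /\
                     {in G, forall g, poly_act rV g f = f}].

(* The coordinates 'X_0, ..., 'X_(n-1) form a triangular basis of the dual:
   g sends each 'X_j into the span of the 'X_i with i <= j. *)
Definition triangular_basis (F : fieldType) (gT : finGroupType)
    (G : {group gT}) (n : nat) (rV : mx_representation F G n) : Prop :=
  {in G, forall g, is_trig_mx (rV g)}.

Definition monomial_order (n : nat) (le : rel 'X_{1..n}) : Prop :=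
  [/\ total le, antisymmetric le, transitive le,
      forall m, le 0%MM m
    & forall m1 m2 m, le m1 m2 -> le (m1 + m)%MM (m2 + m)%MM].

(* The variables are ranked 'X_(s 0) > 'X_(s 1) > ... *)
Definition ranking (n : nat) (le : rel 'X_{1..n}) (s : 'S_n) : Prop :=
  forall i j : 'I_n, (i < j)%N -> le U_(s j)%MM U_(s i)%MM.

(* For upper triangular t, the substituted matrix below gives
   u_j |-> \sum_(i <= j) t i j *: u_i, where u_j is 'X_(s j). *)
Definition borel_fixed (F : fieldType) (n : nat) (le : rel 'X_{1..n})
    (I : set {mpoly F[n]}) : Prop :=
  exists2 s, ranking le s &
  forall t : 'M[F]_n, t \in unitmx -> is_trig_mx t^T ->
  forall f, I f ->
    I (lin_subst (\matrix_(i, j) t ((s^-1)%g i) ((s^-1)%g j)) f).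

Definition initial_monomial (F : fieldType) (n : nat) (le : rel 'X_{1..n})
    (f : {mpoly F[n]}) (m : 'X_{1..n}) : Prop :=
  m \in msupp f /\ {in msupp f, forall m', le m' m}.

Definition initial_ideal (F : fieldType) (n : nat) (le : rel 'X_{1..n})
    (I : set {mpoly F[n]}) : set {mpoly F[n]} :=
  ideal_gen [set h | exists f m,
                       [/\ I f, initial_monomial le f m & h = 'X_[m]]].

Definition monomial_ideal (F : fieldType) (n : nat) (J : set {mpoly F[n]}) :
    Prop :=
  exists E : set 'X_{1..n}, J = ideal_gen [set 'X_[m] | m in E].

Definition zariski_open_GL (F : fieldType) (n : nat) (U : set 'M[F]_n) : Prop :=
  exists Q : set {mpoly F[n * n]},
    U = [set A | A \in unitmx /\
                 exists2 q, Q q & q.@[fun k => mxvec A 0 k] != 0].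

Definition is_gin (F : fieldType) (n : nat) (le : rel 'X_{1..n})
    (I J : set {mpoly F[n]}) : Prop :=
  monomial_ideal J /\
  exists U : set 'M[F]_n, [/\ zariski_open_GL U, U !=set0 &
    forall A, U A -> initial_ideal le (lin_subst A @` I) = J].

(* The default value set0 is not an ideal, so equating gin le I with an ideal
   includes the existence of the generic initial ideal. *)
Definition gin (F : fieldType) (n : nat) (le : rel 'X_{1..n})
    (I : set {mpoly F[n]}) : set {mpoly F[n]} :=
  xget set0 [set J | is_gin le I J].

Definition generic_initial_ideals (F : fieldType) (n : nat)
    (I : set {mpoly F[n]}) : set (set {mpoly F[n]}) :=
  [set J | exists2 le : rel 'X_{1..n}, monomial_order le & J = gin le I].

Definition M_gens (F : fieldType) (p : nat) : set {mpoly F[4]} :=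
  let x1 : {mpoly F[4]} := 'X_(inord 0) in
  let x2 : {mpoly F[4]} := 'X_(inord 1) in
  let x3 : {mpoly F[4]} := 'X_(inord 2) in
  let x4 : {mpoly F[4]} := 'X_(inord 3) in
  [set x1; x2 ^+ 2; x2 * x3 ^+ (p - 3); x3 ^+ (p - 1); x4 ^+ p].

Arguments M_gens F p : clear implicits.

(* Main.v *)
(* Let I be the ideal generated by M.  It is a monomial ideal stable under every
   upper triangular substitution for x_1 > x_2 > x_3 > x_4.  Fix a monomial
   order and let s be the permutation that ranks the variables.  A generic
   linear substitution factors, through the LU decomposition relative to s, as
   an upper triangular substitution, which preserves I, followed by one sending
   each x_j to x_(s j) plus smaller variables.  The latter sends a monomial to
   its image under s plus smaller monomials, hence In(A(I)) = s(I).  So the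
   generic initial ideals are the s(I), and s can be read off s(I) because the
   least pure powers 1, 2, p - 1, p of the four variables in I are distinct. *)
From HB Require Import structures.
From mathcomp Require Import zify ring.
Require Import Defs.

Set Implicit Arguments.
Unset Strict Implicit.
Unset Printing Implicit Defensive.

Import Order.TTheory GRing.Theory.

Local Open Scope classical_set_scope.
Local Open Scope card_scope.
Local Open Scope ring_scope.

(** * Closure properties of generated ideals *)

Section IdealGen.
Variable R : comNzRingType.
Implicit Types S T : set R.

Lemma ideal_gen_sub S : S `<=` ideal_gen S.
Proof.
move=> f Sf; exists 1, (fun=> 1), (fun=> f); split=> //.
by rewrite big_ord1 mul1r.
Qed.

Lemma ideal_gen0 S : ideal_gen S 0.
Proof.
by exists 0, (fun=> 0), (fun=> 0); split=> [[]|] //; rewrite big_ord0.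
Qed.

Lemma ideal_genD S f g : ideal_gen S f -> ideal_gen S g -> ideal_gen S (f + g).
Proof.
case=> k [c [s [Ss ->]]] [l [d [t [St ->]]]].
exists (k + l)%N, (fun i => match split i with inl a => c a | inr b => d b end),
  (fun i => match split i with inl a => s a | inr b => t b end); split.
  by move=> i; case: splitP => j _.
rewrite big_split_ord; congr (_ + _); apply: eq_bigr => i _.
  by rewrite (unsplitK (inl i)).
by rewrite (unsplitK (inr i)).
Qed.

Lemma ideal_genM S f g : ideal_gen S g -> ideal_gen S (f * g).
Proof.
case=> k [c [s [Ss ->]]]; exists k, (fun i => f * c i), s; split=> //.
by rewrite mulr_sumr; apply: eq_bigr => i _; rewrite mulrA.
Qed.

Lemma ideal_gen_expr S f m n :
  (m <= n)%N -> ideal_gen S (f ^+ m) -> ideal_gen S (f ^+ n).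
Proof. by move=> mn Sf; rewrite -(subnK mn) exprD; apply: ideal_genM. Qed.

Lemma ideal_gen_sum S I (r : seq I) (P : pred I) (f : I -> R) :
  (forall i, P i -> ideal_gen S (f i)) -> ideal_gen S (\sum_(i <- r | P i) f i).
Proof.
by move=> Sf; apply: big_ind => //; [apply: ideal_gen0|apply: ideal_genD].
Qed.

Lemma ideal_gen_min S (J : set R) : J 0 ->
    (forall f g, J f -> J g -> J (f + g)) -> (forall f g, J g -> J (f * g)) ->
  S `<=` J -> ideal_gen S `<=` J.
Proof.
move=> J0 JD JM SJ _ [k [c [s [Ss ->]]]].
by apply: big_ind => // i _; apply/JM/SJ.
Qed.

Lemma ideal_gen_le S T : S `<=` ideal_gen T -> ideal_gen S `<=` ideal_gen T.
Proof.
by apply: ideal_gen_min;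
  [apply: ideal_gen0|apply: ideal_genD|apply: ideal_genM].
Qed.

Lemma ideal_gen_eq S T :
  S `<=` ideal_gen T -> T `<=` ideal_gen S -> ideal_gen S = ideal_gen T.
Proof. by move=> ST TS; apply/seteqP; split; apply: ideal_gen_le. Qed.

End IdealGen.

Lemma ideal_gen_morph (R R' : comNzRingType) (h : {rmorphism R -> R'})
    (S : set R) (T : set R') :
    (forall f, S f -> ideal_gen T (h f)) ->
  forall f, ideal_gen S f -> ideal_gen T (h f).
Proof.
move=> hST; apply: ideal_gen_min => //=.
- by rewrite rmorph0; apply: ideal_gen0.
- by move=> f g Tf Tg; rewrite rmorphD; apply: ideal_genD.
- by move=> f g Tg; rewrite rmorphM; apply: ideal_genM.
Qed.

(** * Linear substitutions as algebra morphisms *)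

Section LinSubst.
Variables (F : fieldType) (n : nat).
Implicit Types (A B : 'M[F]_n) (f : {mpoly F[n]}).

HB.instance Definition _ A := GRing.RMorphism.copy (lin_subst A)
  (comp_mpoly [tuple \sum_(i < n) A i j *: 'X_i | j < n]).
HB.instance Definition _ A := GRing.Linear.copy (lin_subst A)
  (comp_mpoly [tuple \sum_(i < n) A i j *: 'X_i | j < n]).

Lemma lin_substX A j : lin_subst A 'X_j = \sum_i A i j *: 'X_i.
Proof. by rewrite /lin_subst comp_mpolyXU -tnth_nth tnth_mktuple. Qed.

Lemma lin_substXm A m : lin_subst A 'X_[m] = \prod_j lin_subst A 'X_j ^+ m j.
Proof.
rewrite /lin_subst comp_mpolyX; apply: eq_bigr => j _.
by rewrite comp_mpolyXU -tnth_nth.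
Qed.

Lemma lin_substE A f : lin_subst A f =
  \sum_(m <- msupp f) f@_m *: lin_subst A 'X_[m].
Proof.
by rewrite {1}[f]mpolyE raddf_sum; apply: eq_bigr => m _ /=; rewrite linearZ.
Qed.

(** Column [j] of a matrix lists the coefficients of the image of ['X_j], so composition does not
    reverse the product. Both sides are multiplicative, which reduces the claim to variables. *)
Lemma lin_substM A B f : lin_subst (A *m B) f = lin_subst A (lin_subst B f).
Proof.
rewrite [in RHS](lin_substE B) lin_substE raddf_sum.
apply: eq_bigr => m _ /=; rewrite linearZ /=; congr (_ *: _).
rewrite !lin_substXm rmorph_prod.
apply: eq_bigr => j _; rewrite [RHS]rmorphXn /=.
suff -> : lin_subst (A *m B) 'X_j = lin_subst A (lin_subst B 'X_j) by [].
rewrite !lin_substX raddf_sum /=.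
under [RHS]eq_bigr => i _.
  rewrite linearZ /= lin_substX scaler_sumr.
  under eq_bigr do rewrite scalerA.
  over.
rewrite exchange_big; apply: eq_bigr => i _ /=.
by rewrite mxE scaler_suml; apply: eq_bigr => k _; rewrite mulrC.
Qed.

Lemma lin_subst1 f : lin_subst 1%:M f = f.
Proof.
rewrite /lin_subst -[RHS]comp_mpoly_id; congr (_ \mPo _).
apply: eq_mktuple => j; rewrite (bigD1 j) //= big1 => [|i /negPf ij].
  by rewrite mxE eqxx scale1r addr0.
by rewrite mxE ij scale0r.
Qed.

End LinSubst.

(** * Triangular matrices and LU decomposition *)

Section Triangular.
Variables (F : fieldType) (n : nat).
Implicit Types A t : 'M[F]_n.

(** Strong induction on the row: in entry [(i, j)] of [t *m v], with [i < j], the terms [k > i]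
    vanish by triangularity and the terms [k < i] by induction, leaving [t i i * v i j = 0]. *)
Lemma trig_invmx t : t \in unitmx -> is_trig_mx t -> is_trig_mx (invmx t).
Proof.
move=> tU /is_trig_mxP tt; set v := invmx t; apply/is_trig_mxP.
have t0 i : t i i != 0.
  move: tU; rewrite unitmxE unitfE det_trig; last exact/is_trig_mxP.
  by move/prodf_neq0; apply.
move=> i; have [m] := ubnP (nat_of_ord i); elim: m i => // m IH i.
rewrite ltnS => im j ij; apply: (mulfI (t0 i)); rewrite mulr0.
have: (t *m v) i j = 0 by rewrite mulmxV // mxE -val_eqE ltn_eqF.
rewrite mxE (bigD1 i) //= big1 ?addr0 // => k ki.
have [ik|] := ltnP i k; first by rewrite tt ?mul0r.
rewrite leq_eqVlt val_eqE (negPf ki) /= => ltki.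
by rewrite IH ?mulr0 ?(leq_trans ltki im) ?(ltn_trans ltki ij).
Qed.

(** Padding with the identity keeps the size [n] for every [j]; the determinant is still the leading
    principal minor of size [j + 1]. *)
Definition lead_block (R : pzRingType) (A : 'M[R]_n) (j : 'I_n) : 'M[R]_n :=
  \matrix_(i, k) if (i <= j)%N && (k <= j)%N then A i k else (i == k)%:R.

(* LU decomposition: column [j] of [t] is column [j] of the inverse of the
   leading block of size [j + 1]. *)
Lemma lower_unitriangularization A :
    (forall j, \det (lead_block A j) != 0) ->
  exists2 t, t \in unitmx /\ is_trig_mx t^T &
    forall i j : 'I_n, (i <= j)%N -> (A *m t) i j = (i == j)%:R.
Proof.
move=> detA; pose w j := invmx (lead_block A j).
have wP j i : \sum_k lead_block A j i k * w j k j = (i == j)%:R.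
  have: (lead_block A j *m w j) i j = (i == j)%:R.
    by rewrite mulmxV ?mxE // unitmxE unitfE.
  by rewrite mxE.
pose t := \matrix_(i, j) w j i j.
(* Below row [j] the padded block has identity rows, so its equation reads off the entry of [t]
   directly. *)
have t0 (i j : 'I_n) : (j < i)%N -> t i j = 0.
  move=> ji; have := wP j i.
  rewrite (bigD1 i) //= big1 ?addr0 => [|k /negPf ki].
    by rewrite !mxE leqNgt ji eqxx mul1r -val_eqE gtn_eqF.
  by rewrite mxE leqNgt ji eq_sym ki mul0r.
have At (i j : 'I_n) : (i <= j)%N -> (A *m t) i j = (i == j)%:R.
  move=> ij; rewrite -wP mxE; apply: eq_bigr => k _.
  rewrite [in RHS]mxE ij /=; have [kj|jk] := leqP k j; first by rewrite !mxE.
  have <-: t k j = w j k j by rewrite mxE.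
  by rewrite !t0 ?mulr0.
exists t => //; split; last by apply/is_trig_mxP => i j ij; rewrite mxE t0.
(* The product is lower unitriangular, which forces [t] to be invertible. *)
have: \det (A *m t) = 1.
  rewrite det_trig; last first.
    apply/is_trig_mxP => i j ij; rewrite At ?(ltnW ij) //.
    by rewrite -val_eqE ltn_eqF.
  by apply: big1 => i _; rewrite At ?eqxx.
rewrite det_mulmx unitmxE => /(congr1 (fun x => x \is a GRing.unit)).
by rewrite unitrM unitr1 => /andP[].
Qed.

End Triangular.

(** The inverse makes this the exponent of the image of a monomial under ['X_i] to ['X_(s i)]. *)
Definition mperm (n : nat) (s : 'S_n) (m : 'X_{1..n}) : 'X_{1..n} :=
  [multinom m ((s^-1)%g i) | i < n].

Lemma msym_mpolyX (F : fieldType) (n : nat) (s : 'S_n) m :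
  msym s 'X_[m] = 'X_[mperm s m] :> {mpoly F[n]}.
Proof. exact: msymX. Qed.

Lemma mpermD n (s : 'S_n) m1 m2 :
  mperm s (m1 + m2)%MM = (mperm s m1 + mperm s m2)%MM.
Proof. by apply/mnmP => i; rewrite !mnmE. Qed.

Lemma mperm_inj n (s : 'S_n) : injective (mperm s).
Proof.
move=> m1 m2 /mnmP e; apply/mnmP => i; have := e (s i).
by rewrite !mnmE permK.
Qed.

(** * Leading monomials after a lower unitriangular substitution *)

Section Leading.
Variables (F : fieldType) (n : nat) (le : rel 'X_{1..n}).
Hypothesis le_order : monomial_order le.
Implicit Types (f g : {mpoly F[n]}) (m : 'X_{1..n}).

Let le_total : total le. Proof. by case: le_order. Qed.
Let le_anti : antisymmetric le. Proof. by case: le_order. Qed.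
Let le_trans : transitive le. Proof. by case: le_order. Qed.
Let le_refl : reflexive le.
Proof. by move=> m; have := le_total m m; rewrite orbb. Qed.
Let leD2r m1 m2 m : le m1 m2 -> le (m1 + m)%MM (m2 + m)%MM.
Proof. by case: le_order => _ _ _ _; apply. Qed.
Let leD m1 m2 k1 k2 : le m1 m2 -> le k1 k2 -> le (m1 + k1)%MM (m2 + k2)%MM.
Proof.
move=> l12 lk; apply: (le_trans (y := (m2 + k1)%MM)); first exact: leD2r.
by rewrite ![(m2 + _)%MM]addmC leD2r.
Qed.

Definition monic_at m f :=
  f@_m = 1 /\ {in msupp f, forall m', le m' m}.

Lemma monic_at1 : monic_at 0%MM 1.
Proof.
split; first by rewrite mcoeff1 eqxx.
by move=> m'; rewrite msupp1 inE => /eqP ->.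
Qed.

Lemma monic_atM m k f g :
  monic_at m f -> monic_at k g -> monic_at (m + k)%MM (f * g).
Proof.
move=> [fm lf] [gk lg]; split; last first.
  by move=> _ /msuppM_le /allpairsP[[a b] /= [/lf am /lg bk ->]]; apply: leD.
(* Once its leading term is split off, [f] no longer contains [m]. A remaining product
   [a + b = m + k] with [a] below [m] and [b] below [k] would force [a = m] by cancellation. *)
have -> : f = 'X_[m] + (f - 'X_[m]) by rewrite addrC subrK.
rewrite mulrDl mcoeffD [X in X@_ _ + _]mulrC mcoeffMX gk.
rewrite memN_msupp_eq0 ?addr0 //.
apply/negP => /msuppM_le /allpairsP[[a b] /= [a_in /lg bk ab]].
have am : a <> m.
  move=> am; move: a_in; rewrite am mcoeff_msupp mcoeffB fm mcoeffX.
  by rewrite eqxx subrr eqxx.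
have lam : le a m.
  apply: lf; move: a_in; rewrite !mcoeff_msupp mcoeffB mcoeffX.
  by have [/esym//|_] := eqVneq m a; rewrite subr0.
apply/am/(@addIm _ b)/le_anti; rewrite leD2r //=.
by rewrite -ab ![(m + _)%MM]addmC leD2r.
Qed.

Lemma monic_at_prod (I : Type) (r : seq I) (k : I -> 'X_{1..n})
    (f : I -> {mpoly F[n]}) :
  (forall i, monic_at (k i) (f i)) ->
  monic_at (\sum_(i <- r) k i)%MM (\prod_(i <- r) f i).
Proof.
move=> kf; elim: r => [|i r IH]; first by rewrite !big_nil; apply: monic_at1.
by rewrite !big_cons; apply: monic_atM.
Qed.

Lemma monic_atX m f e : monic_at m f -> monic_at (m *+ e)%MM (f ^+ e).
Proof.
move=> mf; elim: e => [|e IH]; first by rewrite mulm0n expr0; apply: monic_at1.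
by rewrite mulmS exprS; apply: monic_atM.
Qed.

Lemma initial_monomial_uniq f m1 m2 :
  initial_monomial le f m1 -> initial_monomial le f m2 -> m1 = m2.
Proof. by case=> i1 l1 [i2 l2]; apply: le_anti; rewrite l1 ?l2. Qed.

Variable s : 'S_n.
Hypothesis le_s : ranking le s.

(** Each ['X_j] goes to ['X_(s j)] plus multiples of ['X_(s i)] with [i > j], which the ranking
    places lower; multiplicativity of leading terms does the rest. *)
Lemma lower_monic_at (A : 'M[F]_n) m :
    (forall i j : 'I_n, (i <= j)%N -> A (s i) j = (i == j)%:R) ->
  monic_at (mperm s m) (lin_subst A 'X_[m]).
Proof.
move=> Alow.
have -> : mperm s m = (\sum_i U_(s i) *+ m i)%MM.
  rewrite [LHS]multinomUE_id (reindex_inj (@perm_inj _ s)) /=.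
  by apply: eq_bigr => i _; rewrite mnmE permK.
rewrite lin_substXm; apply: monic_at_prod => j; apply: monic_atX.
rewrite lin_substX; split.
  rewrite raddf_sum (bigD1 (s j)) //= big1 => [|i /negPf ij].
    by rewrite mcoeffZ mcoeffXU eqxx Alow // eqxx mulr1 addr0.
  by rewrite mcoeffZ mcoeffXU ij mulr0.
move=> k /msupp_sum_le /flattenP[_ /mapP[i _ ->]].
rewrite -[i](permKV s); set i' := (s^-1)%g i.
have [ij|ji] := leqP i' j; last first.
  by move/msuppZ_le; rewrite msuppX inE => /eqP ->; apply: le_s.
rewrite Alow //; have [->|_] := eqVneq i' j; last by rewrite scale0r msupp0.
by rewrite scale1r msuppX inE => /eqP ->.
Qed.

(** Distinct monomials of [f] have images with distinct leading monomials, since [mperm s] is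
    injective, so the largest of these cannot cancel. *)
Lemma lower_initial_monomial (A : 'M[F]_n) f :
    (forall i j : 'I_n, (i <= j)%N -> A (s i) j = (i == j)%:R) -> f != 0 ->
  exists2 m, m \in msupp f & initial_monomial le (lin_subst A f) (mperm s m).
Proof.
move=> Alow f0.
have [m m_in m_max] : exists2 m, m \in msupp f &
    {in msupp f, forall m', le (mperm s m') (mperm s m)}.
  move: f0; rewrite -msupp_eq0; elim: (msupp f) => // a [|b r] IH _.
    by exists a => [|m']; rewrite inE // => /eqP ->.
  have [//|m m_in m_max] := IH.
  have [am|ma] := orP (le_total (mperm s a) (mperm s m)).
    exists m; first by rewrite inE m_in orbT.
    by move=> m'; rewrite inE => /orP[/eqP -> //|/m_max].
  exists a; first by rewrite inE eqxx.
  by move=> m'; rewrite inE => /orP[/eqP -> //|/m_max/le_trans]; apply.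
exists m => //; split; last first.
  move=> k; rewrite lin_substE => /msupp_sum_le /flattenP[_ /mapP[m' + ->]].
  rewrite mem_filter /= => /m_max m'm /msuppZ_le k_in.
  by apply: le_trans m'm; apply: (lower_monic_at m' Alow).2.
rewrite mcoeff_msupp lin_substE raddf_sum (bigD1_seq m) //= big_seq_cond.
rewrite big1 => [|m' /andP[/m_max m'm m'Nm]].
  by rewrite mcoeffZ (lower_monic_at m Alow).1 mulr1 addr0 -mcoeff_msupp.
rewrite mcoeffZ [X in _ * X]memN_msupp_eq0 ?mulr0 //.
apply: contra m'Nm => /((lower_monic_at m' Alow).2) mm'.
by apply/eqP/(@mperm_inj _ s)/le_anti; rewrite m'm.
Qed.

End Leading.

(** * Membership in monomial ideals *)

Definition monomials (F : fieldType) (n : nat) (E : set 'X_{1..n}) :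
  set {mpoly F[n]} := [set 'X_[m] | m in E].
Arguments monomials F {n} E.

Lemma monomial_idealP (F : fieldType) (n : nat) (E : set 'X_{1..n})
    (f : {mpoly F[n]}) :
  ideal_gen (monomials F E) f <->
  {in msupp f, forall m, exists2 e, E e & (e <= m)%MM}.
Proof.
split; last first.
  move=> fE; rewrite [f]mpolyE big_seq; apply: ideal_gen_sum => m /fE[e Ee em].
  rewrite -(submK em) mpolyXD -mul_mpolyC mulrA.
  by apply/ideal_genM/ideal_gen_sub; exists e.
(* The divisibility condition itself defines an ideal containing the generators. *)
pose J : set {mpoly F[n]} :=
  [set f | {in msupp f, forall m, exists2 e, E e & (e <= m)%MM}].
apply: (@ideal_gen_min _ _ J) => [m|{}f g fE gE m|{}f g gE m|_ [e Ee <-] m].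
- by rewrite msupp0.
- by move=> /msuppD_le; rewrite mem_cat => /orP[/fE|/gE].
- move=> /msuppM_le /allpairsP[[a b] /= [_ /gE[e Ee eb] ->]].
  by exists e => //; apply: lepm_trans eb (lem_addl _ _).
- by rewrite msuppX inE => /eqP ->; exists e => //; apply: lepm_refl.
Qed.

(** * Generic initial ideals of Borel stable monomial ideals *)

Section BorelGin.
Variables (F : fieldType) (n : nat).
Implicit Types (I J : set {mpoly F[n]}) (le : rel 'X_{1..n}).

(** Stability for the fixed ranking ['X_0 > 'X_1 > ...], whatever monomial order is used later. *)
Definition std_borel I :=
  forall t : 'M[F]_n, t \in unitmx -> is_trig_mx t^T ->
  forall f, I f -> I (lin_subst t f).

(** Inclusion improves to equality because the inverse of [t] is again upper triangular. *)
Lemma std_borel_image I (t : 'M[F]_n) : std_borel I ->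
  t \in unitmx -> is_trig_mx t^T -> lin_subst t @` I = I.
Proof.
move=> bI tU tt; apply/seteqP; split=> [_ [f If <-]|f If]; first exact: bI.
exists (lin_subst (invmx t) f).
  apply: bI => //; first by rewrite unitmx_inv.
  by rewrite trmx_inv; apply: trig_invmx => //; rewrite unitmx_tr.
by rewrite -lin_substM mulmxV // lin_subst1.
Qed.

Lemma msym_monomials (s : 'S_n) E :
  msym s @` monomials F E = monomials F (mperm s @` E).
Proof.
apply/seteqP; split=> [_ [_ [e Ee <-] <-]|_ [_ [e Ee <-] <-]].
  by rewrite msym_mpolyX; exists (mperm s e) => //; exists e.
by exists 'X_[e]; [exists e | rewrite msym_mpolyX].
Qed.

(** Product of the leading principal minors of the generic matrix with rows permuted by [s]; where
    it does not vanish, the LU decomposition relative to [s] exists. *)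
Definition row_minors (s : 'S_n) : {mpoly F[n * n]} :=
  \prod_j \det (lead_block (\matrix_(i, k) 'X_(mxvec_index (s i) k)) j).

Lemma meval_row_minors (s : 'S_n) (A : 'M[F]_n) :
  (row_minors s).@[fun k => mxvec A 0 k] =
  \prod_j \det (lead_block (\matrix_(i, k) A (s i) k) j).
Proof.
rewrite rmorph_prod; apply: eq_bigr => j _; rewrite /= -det_map_mx.
congr (\det _); apply/matrixP => i k; rewrite !mxE.
by case: ifP => _ /=; rewrite ?mxE ?mevalXU ?mxvecE ?rmorph_nat.
Qed.

Lemma borel_gin le (s : 'S_n) (E : set 'X_{1..n}) :
    monomial_order le -> ranking le s ->
    std_borel (ideal_gen (monomials F E)) ->
  is_gin le (ideal_gen (monomials F E))
    (ideal_gen (msym s @` monomials F E)).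
Proof.
move=> le_order le_s bI; rewrite msym_monomials.
split; first by exists (mperm s @` E).
exists [set A | A \in unitmx /\
  exists2 q, [set row_minors s] q & q.@[fun k => mxvec A 0 k] != 0]; split.
- by exists [set row_minors s].
(* Permuting the rows of this matrix by [s] gives the identity, all of whose leading minors are
   1. *)
- exists (perm_mx (s^-1)%g); split; first exact: unitmx_perm.
  exists (row_minors s) => //.
  rewrite meval_row_minors prodf_seq_neq0; apply/allP => j _ /=.
  rewrite (_ : lead_block _ _ = 1%:M) ?det1 ?oner_neq0 //.
  by apply/matrixP => i k; rewrite !mxE permK; case: ifP.
move=> A [_ [_ -> ]]; rewrite meval_row_minors => /prodf_neq0 minorsA.
have [t [tU tt] At] := lower_unitriangularization (fun j => minorsA j isT).
set I := ideal_gen (monomials F E) in bI *.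
(* Since [t] maps [I] onto itself, [A] may be replaced by its lower unitriangular form. *)
have -> : lin_subst A @` I = lin_subst (A *m t) @` I.
  rewrite -[in LHS](std_borel_image bI tU tt).
  apply/seteqP; split=> [_ [_ [f If <-] <-]|_ [f If <-]].
    by exists f => //; rewrite lin_substM.
  by exists (lin_subst t f); [exists f | rewrite lin_substM].
have Alow (i j : 'I_n) : (i <= j)%N -> (A *m t) (s i) j = (i == j)%:R.
  move=> ij; by rewrite -At // !mxE; apply: eq_bigr => k _; rewrite ?mxE.
rewrite /initial_ideal; apply: ideal_gen_eq.
  move=> _ [_ [m [[f If <-] fm ->]]].
  have f0 : f != 0.
    by apply: contraPneq fm.1 => ->; rewrite raddf0 msupp0.
  have [k k_in fk] := lower_initial_monomial le_order le_s Alow f0.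
  rewrite -(initial_monomial_uniq le_order fk fm).
  have [e Ee ek] := (monomial_idealP E f).1 If k k_in.
  rewrite -(submK ek) mpermD mpolyXD; apply/ideal_genM/ideal_gen_sub.
  by exists (mperm s e) => //; exists e.
move=> _ [_ [e Ee <-] <-]; apply: ideal_gen_sub.
exists (lin_subst (A *m t) 'X_[e]), (mperm s e); split => //.
  by exists 'X_[e] => //; apply: ideal_gen_sub; exists e.
have [c1 ?] := lower_monic_at le_order le_s e Alow.
by split=> //; rewrite mcoeff_msupp c1 oner_neq0.
Qed.

End BorelGin.

(** * Uniqueness of the generic initial ideal over an infinite field *)

Section GinUniqueness.
Variables (F : fieldType) (n : nat).
Hypothesis F_infinite : infinite_set [set: F].

Lemma exists_nonroot (q : {poly F}) : q != 0 -> exists x, q.[x] != 0.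
Proof.
move=> q0; have [B _ leB] := infinite_set_fset (size q) F_infinite.
have /negP/allPn[x _ xq] : ~ all (root q) (finmap.enum_fset B).
  move=> /(max_poly_roots q0)/(_ (finmap.fset_uniq B)).
  by rewrite ltnNge leB.
by exists x.
Qed.

(** Restricted to a line of matrices, a polynomial in the entries becomes univariate, so root
    counting applies. *)
Lemma meval_line (q : {mpoly F[n * n]}) (A B : 'M[F]_n) (x : F) :
  (mmap (@polyC F) (fun k => (mxvec A 0 k)%:P + mxvec B 0 k *: 'X) q).[x] =
  q.@[fun k => mxvec (A + x *: B) 0 k].
Proof.
rewrite /mmap mevalE horner_sum; apply: eq_bigr => m _.
rewrite hornerM hornerC /mmap1 horner_prod; congr (_ * _).
apply: eq_bigr => k _; rewrite horner_exp; congr (_ ^+ _).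
by rewrite !hornerE linearD linearZ !mxE mulrC.
Qed.

Lemma det_line (A B : 'M[F]_n) (x : F) :
  (\det (map_mx polyC A + 'X *: map_mx polyC B)).[x] = \det (A + x *: B).
Proof.
rewrite -horner_evalE -det_map_mx; congr (\det _); apply/matrixP => i j.
by rewrite !mxE /= horner_evalE !hornerE.
Qed.

(* Two points of the open sets span a line, on which each of the conditions
   fails for finitely many parameters only. *)
Lemma zariski_open_GL_meet (U V : set 'M[F]_n) :
    zariski_open_GL U -> zariski_open_GL V -> U !=set0 -> V !=set0 ->
  U `&` V !=set0.
Proof.
move=> [P ->] [Q ->] [A [Au [p Pp pA]]] [B [Bu [q Qq qB]]].
pose line r :=
  mmap (@polyC F) (fun k => (mxvec A 0 k)%:P + mxvec (B - A) 0 k *: 'X) r.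
pose d := \det (map_mx polyC A + 'X *: map_mx polyC (B - A)).
(* Parameter 0 gives [A], where [p] and the determinant are nonzero; parameter 1 gives [B], where
   [q] is nonzero. Hence no factor is the zero polynomial. *)
have [x] : exists x, (line p * line q * d).[x] != 0.
  apply: exists_nonroot; rewrite !mulf_neq0 //.
  - apply: contraNneq pA => p0; have := meval_line p A (B - A) 0.
    by rewrite -/(line p) p0 horner0 scale0r addr0 => ->.
  - apply: contraNneq qB => q0; have := meval_line q A (B - A) 1.
    by rewrite -/(line q) q0 horner0 scale1r addrC subrK => ->.
  - move: Au; rewrite unitmxE unitfE; apply: contraNneq => d0.
    have := det_line A (B - A) 0.
    by rewrite -/d d0 horner0 scale0r addr0 => <-.
rewrite !hornerM !mulf_eq0 !negb_or !meval_line det_line.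
move=> /andP[/andP[px qx] dx].
exists (A + x *: (B - A)); split; split; rewrite ?unitmxE ?unitfE //.
  by exists p.
by exists q.
Qed.

(** At a matrix common to the two open sets, both candidates equal the same initial ideal, so the
    choice made by [xget] is forced. *)
Lemma gin_eq (le : rel 'X_{1..n}) (I J : set {mpoly F[n]}) :
  is_gin le I J -> gin le I = J.
Proof.
move=> IJ; apply: xget_unique => // J' [_ [U' [oU' nU' U'J']]].
case: IJ => _ [U [oU nU UJ]].
have [A [UA U'A]] := zariski_open_GL_meet oU oU' nU nU'.
by rewrite -(UJ A UA) (U'J' A U'A).
Qed.

End GinUniqueness.

(** * Monomial orders and the rankings they induce *)

Section Orders.
Variable n : nat.

Lemma monomial_order_ranking (le : rel 'X_{1..n}) :
  monomial_order le -> exists s : 'S_n, ranking le s.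
Proof.
(* The relation is reversed so that sorting lists the largest variable first. *)
case=> le_total _ le_trans _ _; pose r (i j : 'I_n) := le U_(j)%MM U_(i)%MM.
have r_total : total r by move=> i j; apply: le_total.
have r_trans : transitive r by move=> j i k ij jk; apply: le_trans jk ij.
have r_refl : reflexive r by move=> i; have := r_total i i; rewrite orbb.
pose e := sort r (enum 'I_n).
have e_size : size e = n by rewrite size_sort size_enum_ord.
have e_inj : injective (fun i : 'I_n => nth i e i).
  move=> i j; rewrite (set_nth_default j) ?e_size // => /eqP.
  rewrite nth_uniq ?e_size ?sort_uniq ?enum_uniq // => /eqP; exact: val_inj.
exists (perm e_inj) => i j ij; rewrite !permE (set_nth_default i j) ?e_size //.
apply: (sorted_leq_nth r_trans r_refl i (sort_sorted r_total _));
  by rewrite ?inE ?e_size // ltnW.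
Qed.

(** The degree-lexicographic order transported along [s], so that every permutation is the ranking
    of some monomial order. *)
Definition permuted_order (s : 'S_n) : rel 'X_{1..n} :=
  fun m1 m2 => (mperm (s^-1)%g m1 <= mperm (s^-1)%g m2)%O.

Lemma permuted_order_monomial s : monomial_order (permuted_order s).
Proof.
rewrite /permuted_order; split.
- by move=> m1 m2; apply: le_total.
- by move=> m1 m2 /le_anti/mperm_inj.
- by move=> m1 m2 m3; apply: le_trans.
- move=> m; rewrite (_ : mperm _ 0 = 0)%MM ?le0m //.
  by apply/mnmP => i; rewrite !mnmE.
- by move=> m1 m2 m; rewrite !mpermD lemc_add2l.
Qed.

Lemma permuted_order_ranking s : ranking (permuted_order s) s.
Proof.
move=> i j ij; rewrite /permuted_order.
have mpermU k : mperm (s^-1)%g U_(s k) = U_(k)%MM.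
  by apply/mnmP => l; rewrite !mnmE invgK (inj_eq perm_inj).
rewrite !mpermU; apply/ltW/ltmcP; first by rewrite !mdeg1.
exists i => [k ki|]; rewrite !mnmE.
  by rewrite -!val_eqE !gtn_eqF // (ltn_trans ki).
by rewrite eqxx -val_eqE gtn_eqF.
Qed.

End Orders.

Lemma card_eq_finType (T : finType) : [set: T] #= `I_#|T|.
Proof.
apply/pcard_eqP/bijPex; exists (fun x => enum_rank x : nat).
split=> [x _|x y _ _|k /= kT].
- exact: ltn_ord.
- by move/val_inj/enum_rank_inj.
- by exists (enum_val (Ordinal kT)); rewrite // enum_valK.
Qed.

(** * Pure powers distinguish the permuted ideals *)

Section PurePowers.
Variables (F : fieldType) (p : nat).
Implicit Types (i : 'I_4) (f : {mpoly F[4]}).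

Definition M_exponents : set 'X_{1..4} :=
  [set U_(inord 0); U_(inord 1) *+ 2; U_(inord 1) + U_(inord 2) *+ (p - 3);
       U_(inord 2) *+ (p - 1); U_(inord 3) *+ p]%MM.

Lemma M_gensE : M_gens F p = monomials F M_exponents.
Proof.
rewrite /M_gens /monomials /M_exponents !image_setU !image_set1.
by rewrite mpolyXD -!mpolyXn.
Qed.

Definition pure_exponent i := nth 0%N [:: 1; 2; p - 1; p]%N i.

Lemma M_exponents_pure i : M_exponents (U_(i) *+ pure_exponent i)%MM.
Proof.
rewrite -[i in U_(i)%MM]inord_val /M_exponents /pure_exponent.
case: i => -[|[|[|[|//]]]] ilt /=; rewrite ?mulm1n.
- by do 4 left.
- by do 3 left; right.
- by left; right.
- by right.
Qed.

Hypothesis p_ge5 : (5 <= p)%N.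

(** A monomial generator dividing a pure power involves one variable only. As [p - 3] is positive,
    this excludes the mixed generator and leaves one generator per variable. *)
Lemma pure_power_in_M i k (s : 'S_4) :
  ideal_gen (msym s @` M_gens F p) ('X_(s i) ^+ k) <-> (pure_exponent i <= k)%N.
Proof.
rewrite M_gensE msym_monomials mpolyXn; rewrite monomial_idealP; split.
  case/(_ (U_(s i) *+ k)%MM); first by rewrite msuppX inE.
  move=> _ [e Ee <-] /mnm_lepP le_e.
  have {}le_e j : (e j <= (i == j) * k)%N.
    have := le_e (s j); rewrite mnmE permK mulmnE mnm1E.
    by rewrite (inj_eq perm_inj).
  have H0 := le_e (inord 0); have H1 := le_e (inord 1).
  have H2 := le_e (inord 2); have H3 := le_e (inord 3).
  move: H0 H1 H2 H3 {le_e}; rewrite /pure_exponent -!val_eqE /= !inordK //.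
  case: Ee => [[[[]|]|]|] ->;
  rewrite !(mnmDE, mulmnE, mnm1E) -!val_eqE /= !inordK //=;
  case: i => -[|[|[|[|//]]]] ? /=; lia.
move=> ik m; rewrite msuppX inE => /eqP ->.
exists (mperm s (U_(i) *+ pure_exponent i)%MM).
  by exists (U_(i) *+ pure_exponent i)%MM => //; apply: M_exponents_pure.
apply/mnm_lepP => j; rewrite mnmE !mulmnE !mnm1E.
by rewrite (can2_eq (permK s) (permKV s)) leq_mul2l ik orbT.
Qed.

Lemma M_sym_inj : injective (fun s : 'S_4 => ideal_gen (msym s @` M_gens F p)).
Proof.
move=> s t st; apply/permP => i; set j := (t^-1)%g (s i).
have sij : s i = t j by rewrite permKV.
have {}st : ideal_gen (msym s @` M_gens F p) = ideal_gen (msym t @` M_gens F p).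
  exact: st.
have ij : pure_exponent j = pure_exponent i.
  apply/eqP; rewrite eqn_leq; apply/andP; split.
    by apply/(pure_power_in_M j _ t); rewrite -sij -st; apply/pure_power_in_M.
  by apply/(pure_power_in_M i _ s); rewrite sij st; apply/pure_power_in_M.
suff ji : j = i by rewrite sij ji.
apply/val_inj; move: ij; rewrite /pure_exponent.
by case: (j) => -[|[|[|[|//]]]] ? /=; case: (i) => -[|[|[|[|//]]]] ? /=; lia.
Qed.

End PurePowers.

(** * Borel stability of the ideal generated by [M] *)

Lemma sum_ord4 (V : nmodType) (f : 'I_4 -> V) :
  \sum_i f i = f (inord 0) + f (inord 1) + f (inord 2) + f (inord 3).
Proof.
rewrite !big_ord_recl big_ord0 addr0 !addrA.
by congr (f _ + f _ + f _ + f _); apply/val_inj; rewrite /= inordK.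
Qed.

(** Binomial expansion modulo [a] and [b ^+ 2]. The induction produces [v = k + 1], but only its
    existence matters. *)
Lemma trinomial_mod (R : comNzRingType) (a b c : R) k :
  exists q r v, (a + b + c) ^+ k.+1 =
    q * a + r * b ^+ 2 + v * b * c ^+ k + c ^+ k.+1.
Proof.
elim: k => [|k [q [r [v IH]]]]; first by exists 1, 0, 1; ring.
exists (q * (a + b + c) + r * b ^+ 2 + v * b * c ^+ k + c ^+ k.+1),
  (r * (b + c) + v * c ^+ k), (v + 1).
rewrite exprS IH !exprS; ring.
Qed.

Section TrinomialPowers.
Variables (R : comNzRingType) (S : set R) (x0 x1 x2 : R) (k : nat).
Hypotheses (I0 : ideal_gen S x0) (I1 : ideal_gen S (x1 ^+ 2)).
Hypothesis I12 : ideal_gen S (x1 * x2 ^+ k.+1).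

(** This is the image of [x1 * x2 ^+ k.+1]. Modulo [x0] and [x1 ^+ 2], only a multiple of that
    monomial survives. *)
Lemma ideal_gen_linear_trinomial (a b c d e : R) :
  ideal_gen S ((a * x0 + b * x1) * (c * x0 + d * x1 + e * x2) ^+ k.+1).
Proof.
have [q [r [v ->]]] := trinomial_mod (c * x0) (d * x1) (e * x2) k.
set y := a * x0 + b * x1.
have -> : y * (q * (c * x0) + r * (d * x1) ^+ 2
      + v * (d * x1) * (e * x2) ^+ k + (e * x2) ^+ k.+1)
  = (y * q * c + a * (v * (d * x1) * (e * x2) ^+ k + (e * x2) ^+ k.+1)) * x0
    + (y * r * d ^+ 2 + b * v * d * (e * x2) ^+ k) * x1 ^+ 2
    + b * e ^+ k.+1 * (x1 * x2 ^+ k.+1).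
  by rewrite /y !exprMn !exprS; ring.
by apply: ideal_genD; [apply: ideal_genD|]; apply: ideal_genM.
Qed.

(** The surviving cross term contains [x1 * x2 ^+ k.+2], a multiple of the mixed generator. *)
Lemma ideal_gen_trinomial (c d e : R) : ideal_gen S (x2 ^+ k.+3) ->
  ideal_gen S ((c * x0 + d * x1 + e * x2) ^+ k.+3).
Proof.
move=> I2; have [q [r [v ->]]] := trinomial_mod (c * x0) (d * x1) (e * x2) k.+2.
have -> : q * (c * x0) + r * (d * x1) ^+ 2
      + v * (d * x1) * (e * x2) ^+ k.+2 + (e * x2) ^+ k.+3
  = (q * c) * x0 + (r * d ^+ 2) * x1 ^+ 2
    + (v * d * e ^+ k.+2 * x2) * (x1 * x2 ^+ k.+1) + e ^+ k.+3 * x2 ^+ k.+3.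
  by rewrite !exprMn !exprS; ring.
by apply: ideal_genD;
  [apply: ideal_genD; [apply: ideal_genD|]|]; apply: ideal_genM.
Qed.

End TrinomialPowers.

Lemma M_std_borel (F : fieldType) (p : nat) :
  p \in [pchar F] -> (5 <= p)%N -> std_borel (ideal_gen (M_gens F p)).
Proof.
move=> pF p5 t _ /is_trig_mxP tt f; set I := ideal_gen (M_gens F p).
have t0 (i j : nat) : (i < 4)%N -> (j < i)%N -> t (inord i) (inord j) = 0.
  move=> i4 ji; have := tt (inord j) (inord i).
  by rewrite mxE !inordK // => [->//|]; lia.
set x0 : {mpoly F[4]} := 'X_(inord 0); set x1 : {mpoly F[4]} := 'X_(inord 1).
set x2 : {mpoly F[4]} := 'X_(inord 2); set x3 : {mpoly F[4]} := 'X_(inord 3).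
have I0 : I x0 by apply: ideal_gen_sub; do 4 left.
have I1 : I (x1 ^+ 2) by apply: ideal_gen_sub; do 3 left; right.
have I12 : I (x1 * x2 ^+ (p - 3)) by apply: ideal_gen_sub; do 2 left; right.
have I2 : I (x2 ^+ (p - 1)) by apply: ideal_gen_sub; left; right.
have I3 : I (x3 ^+ p) by apply: ideal_gen_sub; right.
pose c i j : {mpoly F[4]} := (t (inord i) (inord j))%:MP.
pose c00 := c 0%N 0%N; pose c01 := c 0%N 1%N; pose c11 := c 1%N 1%N.
pose c02 := c 0%N 2%N; pose c12 := c 1%N 2%N; pose c22 := c 2%N 2%N.
pose c03 := c 0%N 3%N; pose c13 := c 1%N 3%N.
pose c23 := c 2%N 3%N; pose c33 := c 3%N 3%N.
have y0 : lin_subst t x0 = c00 * x0.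
  rewrite lin_substX sum_ord4 (t0 1%N) // (t0 2%N) // (t0 3%N) //.
  by rewrite !scale0r !addr0 -mul_mpolyC.
have y1 : lin_subst t x1 = c01 * x0 + c11 * x1.
  rewrite lin_substX sum_ord4 (t0 2%N) // (t0 3%N) //.
  by rewrite !scale0r !addr0 -!mul_mpolyC.
have y2 : lin_subst t x2 = c02 * x0 + c12 * x1 + c22 * x2.
  by rewrite lin_substX sum_ord4 (t0 3%N) // !scale0r !addr0 -!mul_mpolyC.
have y3 : lin_subst t x3 = c03 * x0 + c13 * x1 + c23 * x2 + c33 * x3.
  by rewrite lin_substX sum_ord4 -!mul_mpolyC.
(* With this shift [p - 3] is [k.+1] and [p - 1] is [k.+3], the exponents of the trinomial
   lemmas. *)
have [k pk] : exists k, p = k.+4 by exists (p - 4)%N; lia.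
apply: (ideal_gen_morph (h := lin_subst t)) => {f} _ [[[[->|->]|->]|->]|->] /=.
- by rewrite y0; apply: ideal_genM.
- rewrite rmorphXn /= y1.
  have -> : (c01 * x0 + c11 * x1) ^+ 2 =
    (c01 ^+ 2 * x0 + 2%:R * c01 * c11 * x1) * x0 + c11 ^+ 2 * x1 ^+ 2.
    by ring.
  by apply: ideal_genD; apply: ideal_genM.
- rewrite rmorphM rmorphXn /= y1 y2.
  move: I12; rewrite (_ : p - 3 = k.+1)%N; last by lia.
  by move=> I12; apply: ideal_gen_linear_trinomial.
- rewrite rmorphXn /= y2.
  move: I12 I2; rewrite (_ : p - 3 = k.+1)%N; last by lia.
  rewrite (_ : p - 1 = k.+3)%N; last by lia.
  by move=> I12 I2; apply: ideal_gen_trinomial.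
(* By additivity of Frobenius the image of [x3 ^+ p] is a combination of the [p]-th powers of the
   variables, each a multiple of a pure power in [M]. *)
have pR : p \in [pchar {mpoly F[4]}] by rewrite pchar_lalg.
rewrite rmorphXn /= y3 -(pFrobenius_autE pR) !rmorphD /=.
rewrite !pFrobenius_autE !exprMn.
apply: ideal_genD; [apply: ideal_genD; [apply: ideal_genD|]|];
  apply: ideal_genM => //.
- by apply: (@ideal_gen_expr _ _ _ 1); rewrite ?expr1 //; lia.
- by apply: (@ideal_gen_expr _ _ _ 2) => //; lia.
- by apply: (@ideal_gen_expr _ _ _ (p - 1)) => //; lia.
Qed.

(** * Generic initial ideals of the Hilbert ideal, parametrized by permutations *)

Theorem proposition5 (p : nat) (F : fieldType)
    (gT : finGroupType) (G : {group gT}) (rV : mx_representation F G 4)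
    (p_prime : prime p) (p_ge5 : (5 <= p)%N)
    (F_infinite : infinite_set [set: F]) (F_char : p \in [pchar F])
    (G_cyclic : cyclic G) (G_order : #|G| = p)
    (V4 : is_V rV) (x_triangular : triangular_basis rV)
    (M_generates : hilbert_ideal rV = ideal_gen (M_gens F p)) :
  [/\ exists2 le : rel 'X_{1..4}, monomial_order le &
        borel_fixed le (hilbert_ideal rV),
      generic_initial_ideals (hilbert_ideal rV) #= `I_(4`!)
    & forall J, generic_initial_ideals (hilbert_ideal rV) J ->
        exists s : 'S_4, J = ideal_gen (msym s @` M_gens F p)].
Proof.
rewrite M_generates; have borelM := M_std_borel F_char p_ge5.
have ginM le (s : 'S_4) : monomial_order le -> ranking le s ->
    gin le (ideal_gen (M_gens F p)) = ideal_gen (msym s @` M_gens F p).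
  move=> le_order le_s; apply: gin_eq => //.
  by rewrite M_gensE; apply: borel_gin => //; rewrite -M_gensE.
have gins : generic_initial_ideals (ideal_gen (M_gens F p)) =
    (fun s : 'S_4 => ideal_gen (msym s @` M_gens F p)) @` setT.
  apply/seteqP; split=> [J [le le_order ->]|_ [s _ <-]].
    have [s le_s] := monomial_order_ranking le_order.
    by exists s; rewrite // (ginM _ s).
  exists (permuted_order s); first exact: permuted_order_monomial.
  by rewrite (ginM _ s) //;
    [exact: permuted_order_monomial|exact: permuted_order_ranking].
split.
(* For the identity ranking, the reindexing of the matrix in [borel_fixed] disappears. *)
- exists (permuted_order 1); first exact: permuted_order_monomial.
  exists 1%g; first exact: permuted_order_ranking.
  move=> t tU tt f If; rewrite (_ : \matrix_(i, j) _ = t); first exact: borelM.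
  by apply/matrixP => i j; rewrite mxE invg1 !perm1.
- rewrite gins -card_Sn; apply: card_eq_trans (card_eq_finType _).
  by apply: inj_card_eq => s t _ _; apply: M_sym_inj.
- by rewrite gins => _ [s _ <-]; exists s.
Qed.
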